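(* Let $n\ge 2$ and let $\rho_{\mathrm{Aff}}:\tilde{A}_{n-1}\to\operatorname{Aut}F_n$ be the homomorphism defined in the context. (i) $\rho_{\mathrm{Aff}}$ is injective. (ii) An automorphism $\phi\in\operatorname{Aut}F_n$ lies in $\rho_{\mathrm{Aff}}(\tilde{A}_{n-1})$ if and only if there exist $w_1,\dots,w_n\in F_n$ and a permutation $\pi\in\mathcal{S}_n$ with $\phi(x_i)=w_i\,x_{\pi(i)}\,w_i^{-1}$ for all $i$, and there exists $w\in F_n$ of algebraic length $\ell(w)=0$ (sum of the exponents of all letters) with $\phi(x_1x_2\cdots x_n)=w\,x_1x_2\cdots x_n\,w^{-1}$.
   Context: $F_n$ is the free group on $x_1,\dots,x_n$. The affine braid group $\tilde{A}_{n-1}$ is the group with generators $\sigma_1,\dots,\sigma_n$ and relations (indices mod $n$) $\sigma_i\sigma_{i+1}\sigma_i=\sigma_{i+1}\sigma_i\sigma_{i+1}$ for all $i$, and $\sigma_i\sigma_j=\sigma_j\sigma_i$ for $|i-j|\ne 1\bmod n$. The homomorphism $\rho_{\mathrm{Aff}}$ is defined by: for $i\ne n$, $\rho_{\mathrm{Aff}}(\sigma_i)$: $x_i\mapsto x_ix_{i+1}x_i^{-1}$, $x_{i+1}\mapsto x_i$, $x_j\mapsto x_j$ ($j\ne i,i+1$); and $\rho_{\mathrm{Aff}}(\sigma_n)$: $x_1\mapsto x_n$, $x_n\mapsto x_nx_1x_n^{-1}$, $x_j\mapsto x_j$ ($j\ne 1,n$).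
   Formalization: For n=2 the listed relation σ1σ2σ1=σ2σ1σ2 is not respected by ρ_Aff, so the homomorphism is undefined there; ρ_Aff is taken on words in the σ_i^{±1}, its image is that of all words, and (i) says that words with equal images are equal in the presented group. *)

(* Defs.v *)
From HB Require Import structures.
From mathcomp Require Import all_boot all_order all_algebra all_fingroup.
Set Implicit Arguments. Unset Strict Implicit. Unset Printing Implicit Defensive.

(* A letter (i, false) is x_i, (i, true) is x_i^{-1}; indices are 0-based,
   so x_i of the paper is (i-1). *)
Definition letter (n : nat) := ('I_n * bool)%type.
Definition word (n : nat) := seq (letter n).

Definition inv_letter n (a : letter n) : letter n := (a.1, ~~ a.2).
Definition winv n (w : word n) : word n := rev (map (@inv_letter n) w).

Definition push n (a : letter n) (s : word n) : word n :=
  match s with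
  | b :: s' => if b == inv_letter a then s' else a :: s
  | [::] => [:: a]
  end.
Definition freduce n (w : word n) : word n := foldr (@push n) [::] w.

Definition feq n (u v : word n) : Prop := freduce u = freduce v.

Definition gen n (i : 'I_n) : word n := [:: (i, false)].

Definition subst n (f : 'I_n -> word n) (w : word n) : word n :=
  flatten (map (fun a : letter n => if a.2 then winv (f a.1) else f a.1) w).

Definition alg_len n (w : word n) : int :=
  (\sum_(a <- w) (if a.2 then (-1)%R else 1%R))%R.

Definition prod_gens n : word n := [seq (i, false) | i <- enum 'I_n].

Definition is_aut n (f : 'I_n -> word n) : Prop :=
  exists g : 'I_n -> word n,
    forall i, feq (subst f (g i)) (gen i) /\ feq (subst g (f i)) (gen i).

(* Affine braid group: generator sigma_{i+1} of the paper is index i : 'I_n;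
   (i, false) is sigma, (i, true) is sigma^{-1}. Indices mod n via ordS. *)
Definition bword (n : nat) := seq ('I_n * bool).

Inductive bequiv n : bword n -> bword n -> Prop :=
| be_refl u : bequiv u u
| be_sym u v : bequiv u v -> bequiv v u
| be_trans u v w : bequiv u v -> bequiv v w -> bequiv u w
| be_cat u u' v v' : bequiv u u' -> bequiv v v' -> bequiv (u ++ v) (u' ++ v')
| be_free (a : 'I_n * bool) : bequiv [:: a; (a.1, ~~ a.2)] [::]
| be_braid (i : 'I_n) :
    bequiv [:: (i, false); (ordS i, false); (i, false)]
           [:: (ordS i, false); (i, false); (ordS i, false)]
| be_comm (i j : 'I_n) : j != ordS i -> i != ordS j ->
    bequiv [:: (i, false); (j, false)] [:: (j, false); (i, false)].

(* rho_Aff(sigma_i): x_i |-> x_i x_{i+1} x_i^{-1}, x_{i+1} |-> x_i (indices mod n);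
   this covers sigma_n as well: x_n |-> x_n x_1 x_n^{-1}, x_1 |-> x_n. *)
Definition rho_sigma n (i : 'I_n) (k : 'I_n) : word n :=
  if k == i then [:: (i, false); (ordS i, false); (i, true)]
  else if k == ordS i then [:: (i, false)]
  else gen k.

Definition rho_sigma_inv n (i : 'I_n) (k : 'I_n) : word n :=
  if k == i then [:: (ordS i, false)]
  else if k == ordS i then [:: (ordS i, true); (i, false); (ordS i, false)]
  else gen k.

Definition rho_gen n (a : 'I_n * bool) : 'I_n -> word n :=
  if a.2 then rho_sigma_inv a.1 else rho_sigma a.1.

(* rho_Aff of a braid word, as generator images; rho(a b) = rho(a) o rho(b) *)
Fixpoint rho n (b : bword n) : 'I_n -> word n :=
  match b with
  | [::] => @gen n
  | a :: b' => fun k => subst (rho_gen a) (rho b' k)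
  end.

(* Main.v *)
Require Import Defs.
From HB Require Import structures.
From mathcomp Require Import all_boot all_order all_algebra all_fingroup.
From mathcomp Require Import zify.
Set Implicit Arguments. Unset Strict Implicit. Unset Printing Implicit Defensive.

(** Precomposing [f] with [rho_Aff(sigma_i^{+-1})] is a Hurwitz move on the cyclic tuple
    [(f x_1, ..., f x_n)]: one of two cyclically adjacent entries is conjugated by the other
    and they trade places.  For a tuple of conjugates [u_k x_{pi k} u_k^{-1}] every move
    strictly changes the total length, and it shortens iff the word of the conjugated entry
    starts with [u_p x_{pi p}^{-+1}], where [p] is the conjugating ("absorbing") entry.

    If the cyclic product of the tuple is conjugate to [x_1 ... x_n] and no entry shortens
    exactly one of its neighbours, then replacing the central letter of each entry that shortens
    both neighbours by its inverse exhibits a cyclically reduced word for the product.  It must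
    be a rotation of [x_1 ... x_n], so all [u_k] are trivial; the condition [l(w) = 0] excludes
    nontrivial rotations.  Descent on the total length yields (ii).

    For (i), two shortening moves at a tuple, other than the two moves of a common absorbing
    entry, are completed by a commutation or braid relation to paths below that tuple.  Descending
    along an entry that shortens only one neighbour avoids the excluded pair, so by induction on
    length two braid words with the same effect are equivalent.  For [n = 2] adjacent entries meet
    on both sides and no braid relation is ever needed. *)

(** * The free group *)

Section FreeGroup.
Variable n : nat.
Implicit Types (a b : letter n) (u v w s p : word n).

Lemma inv_letterK : involutive (@inv_letter n).
Proof. by case=> i e; rewrite /inv_letter /= negbK. Qed.

Definition nocancel : rel (letter n) := [rel a b | b != inv_letter a].

Definition reduced (w : word n) : bool := sorted nocancel w.

Lemma nocancel_inv a b : nocancel (inv_letter b) (inv_letter a) = nocancel a b.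
Proof.
by rewrite /nocancel /= inv_letterK -(inj_eq (inv_inj inv_letterK)) inv_letterK eq_sym
           -(inj_eq (inv_inj inv_letterK)) inv_letterK eq_sym.
Qed.

Lemma nocancel_idx a b : a.1 != b.1 -> nocancel a b.
Proof. by apply: contraNneq => ->. Qed.

Lemma reduced_winv w : reduced (winv w) = reduced w.
Proof.
rewrite /reduced /winv rev_sorted sorted_map.
by apply: eq_sorted => a b; rewrite /= nocancel_inv.
Qed.

Lemma winv_cat u v : winv (u ++ v) = winv v ++ winv u.
Proof. by rewrite /winv map_cat rev_cat. Qed.

Lemma winvK : involutive (@winv n).
Proof.
by move=> w; rewrite /winv map_rev revK -map_comp map_id_in // => a _ /=; rewrite inv_letterK.
Qed.

Lemma size_winv w : size (winv w) = size w.
Proof. by rewrite /winv size_rev size_map. Qed.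

Lemma reduced_push a s : reduced s -> reduced (push a s).
Proof.
case: s => //= b s rs; case: ifPn => [_|h]; first exact: path_sorted rs.
by rewrite /reduced /= rs andbT.
Qed.

Lemma reduced_freduce w : reduced (freduce w).
Proof. by elim: w => //= a w; apply: reduced_push. Qed.

Lemma freduce_id w : reduced w -> freduce w = w.
Proof.
elim: w => //= a w IH rw; rewrite (IH (path_sorted rw)).
by case: w {IH} rw => //= b w /andP[/negbTE ->].
Qed.

Lemma push_inv a s : reduced s -> push a (push (inv_letter a) s) = s.
Proof.
case: s => [|b s] /= rs; first by rewrite eqxx.
rewrite inv_letterK; case: (eqVneq b a) => [ba|nba] /=; last by rewrite eqxx.
by subst b; case: s rs => //= c s /andP[/negbTE ->].
Qed.

Lemma push_invV a s : reduced s -> push (inv_letter a) (push a s) = s.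
Proof. by move=> rs; rewrite -{2}[a]inv_letterK push_inv. Qed.

Lemma reduced_foldr u s : reduced s -> reduced (foldr (@push n) s u).
Proof. by move=> rs; elim: u => //= a u; apply: reduced_push. Qed.

Lemma foldr_push_push a u s : reduced s ->
  foldr (@push n) s (push a u) = push a (foldr (@push n) s u).
Proof.
case: u => //= b u rs; case: eqP => //= ->.
by rewrite push_inv // reduced_foldr.
Qed.

Lemma foldr_freduce u s : reduced s ->
  foldr (@push n) s (freduce u) = foldr (@push n) s u.
Proof. by move=> rs; elim: u => //= a u IH; rewrite foldr_push_push // IH. Qed.

Lemma freduce_catE u v : freduce (u ++ v) = foldr (@push n) (freduce v) u.
Proof. by rewrite /freduce foldr_cat. Qed.

Lemma freduce_cat u v : freduce (freduce u ++ freduce v) = freduce (u ++ v).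
Proof.
by rewrite !freduce_catE (freduce_id (reduced_freduce v)) foldr_freduce ?reduced_freduce.
Qed.

Lemma freduce_winv_cat u : freduce (winv u ++ u) = [::].
Proof.
elim: u => //= a u IH.
rewrite -cat1s winv_cat -catA freduce_catE /=.
by rewrite push_invV ?reduced_freduce -?freduce_catE.
Qed.

Lemma size_push a s : size (push a s) <= (size s).+1.
Proof. by case: s => //= b s; case: ifP => //= _; lia. Qed.

Lemma size_freduce w : size (freduce w) <= size w.
Proof. by elim: w => //= a w IH; apply: leq_trans (size_push _ _) _. Qed.

Definition fgroup := {w : word n | reduced w}.
HB.instance Definition _ := [isSub of fgroup for @sval _ _].
HB.instance Definition _ := [Choice of fgroup by <:].

Definition cls (w : word n) : fgroup := exist _ (freduce w) (reduced_freduce w).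

Lemma val_cls w : val (cls w) = freduce w. Proof. by []. Qed.

Lemma clsK (g : fgroup) : cls (val g) = g.
Proof. by apply: val_inj; rewrite val_cls freduce_id //; apply: valP. Qed.

Lemma feqE u v : feq u v <-> cls u = cls v.
Proof. by split=> [h|/(congr1 val)]; [apply: val_inj; rewrite !val_cls | ]. Qed.

Definition fmul (g h : fgroup) := cls (val g ++ val h).
Definition finv (g : fgroup) := cls (winv (val g)).

Lemma fmul_cls u v : fmul (cls u) (cls v) = cls (u ++ v).
Proof. by apply: val_inj; rewrite !val_cls freduce_cat. Qed.

Lemma fmulA : associative fmul.
Proof.
move=> g h k; rewrite -[g]clsK -[h]clsK -[k]clsK.
by rewrite !fmul_cls catA.
Qed.

Lemma fmul1 : left_id (cls [::]) fmul.
Proof. by move=> g; rewrite -[g]clsK fmul_cls. Qed.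

Lemma fmulr1 : right_id (cls [::]) fmul.
Proof. by move=> g; rewrite -[g]clsK fmul_cls cats0. Qed.

Lemma fmulV : left_inverse (cls [::]) finv fmul.
Proof.
move=> g; rewrite -{2}[g]clsK fmul_cls.
by apply: val_inj; rewrite !val_cls freduce_winv_cat.
Qed.

Lemma fmulrV : right_inverse (cls [::]) finv fmul.
Proof.
move=> g; rewrite -{1}[g]clsK fmul_cls -{1}[val g]winvK.
by apply: val_inj; rewrite !val_cls freduce_winv_cat.
Qed.

HB.instance Definition _ := isGroup.Build fgroup fmulA fmul1 fmulr1 fmulV fmulrV.

Local Open Scope group_scope.

Lemma cls_nil : cls [::] = 1. Proof. by []. Qed.

Lemma cls_cat u v : cls (u ++ v) = cls u * cls v.
Proof. by rewrite -fmul_cls. Qed.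

Lemma cls_cons a v : cls (a :: v) = cls [:: a] * cls v.
Proof. by rewrite -cls_cat. Qed.

Lemma cls_winv u : cls (winv u) = (cls u)^-1.
Proof.
apply/esym/mulg1_eq; rewrite -cls_cat.
by apply: val_inj; rewrite -{1}[u]winvK val_cls freduce_winv_cat.
Qed.

Lemma cls_inv_letter a : cls [:: inv_letter a] = (cls [:: a])^-1.
Proof. by rewrite -cls_winv. Qed.

Lemma cls_flatten (T : Type) (F : T -> word n) (r : seq T) :
  cls (flatten (map F r)) = \prod_(i <- r) cls (F i).
Proof.
elim: r => [|i r IH] /=; first by rewrite big_nil.
by rewrite big_cons cls_cat IH.
Qed.

Definition len (g : fgroup) := size (val g).

Lemma len_cls w : len (cls w) <= size w.
Proof. exact: size_freduce. Qed.

Lemma reduced_cls_inj u v : reduced u -> reduced v -> cls u = cls v -> u = v.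
Proof. by move=> ru rv /(congr1 val); rewrite !val_cls !freduce_id. Qed.

Definition fgen (i : 'I_n) : fgroup := cls (gen i).

Lemma alg_len_cat u v : alg_len (u ++ v) = (alg_len u + alg_len v)%R.
Proof. by rewrite /alg_len big_cat. Qed.

Lemma alg_len_cons a v : alg_len (a :: v) = ((if a.2 then -1 else 1) + alg_len v)%R.
Proof. by rewrite /alg_len big_cons. Qed.

Lemma alg_len_push a s : alg_len (push a s) = alg_len (a :: s).
Proof.
case: s => [|b s] //=; case: eqP => // ->.
by rewrite !alg_len_cons /=; case: (a.2) => /=; lia.
Qed.

Lemma alg_len_freduce w : alg_len (freduce w) = alg_len w.
Proof. by elim: w => //= a w IH; rewrite alg_len_push !alg_len_cons IH. Qed.

Definition ell (g : fgroup) : int := alg_len (val g).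

Lemma ell_cls w : ell (cls w) = alg_len w.
Proof. exact: alg_len_freduce. Qed.

Lemma ellM g h : ell (g * h) = (ell g + ell h)%R.
Proof. by rewrite -[g]clsK -[h]clsK -cls_cat !ell_cls alg_len_cat. Qed.

Lemma ell1 : ell 1 = 0%R.
Proof. by rewrite -cls_nil ell_cls /alg_len big_nil. Qed.

Lemma ellV g : ell g^-1 = (- ell g)%R.
Proof. by apply/eqP; rewrite -GRing.subr_eq0 GRing.opprK -ellM mulVg ell1. Qed.

End FreeGroup.

(** * Reduced conjugates of generators *)

Section Conjugates.
Variable n : nat.
Implicit Types (a b : letter n) (u v w s p t : word n) (i j : 'I_n).
Local Open Scope group_scope.

Lemma reduced_cat_cons u a v :
  reduced (u ++ a :: v) = reduced (rcons u a) && reduced (a :: v).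
Proof. exact: sorted_cat_cons. Qed.

Lemma reduced_rcons2 u a b : reduced (rcons (rcons u a) b) = reduced (rcons u a) && nocancel a b.
Proof. by rewrite -(cats1 _ b) cat_rcons reduced_cat_cons /reduced /= andbT. Qed.

Lemma reduced_cons_rcons a w b : (w = [::] -> nocancel a b) ->
  reduced (a :: w) -> reduced (rcons w b) -> reduced (a :: rcons w b).
Proof.
case: w => [|c w] /=; first by move=> /(_ erefl); rewrite /reduced /= => ->.
by move=> _ /andP[ac _] cb; rewrite /reduced /= ac.
Qed.

Lemma reduced_cat_l u v : reduced (u ++ v) -> reduced u.
Proof. by case/cat_sorted2. Qed.

Lemma reduced_cat_r u v : reduced (u ++ v) -> reduced v.
Proof. by case/cat_sorted2. Qed.

Lemma winv_cons a u : winv (a :: u) = rcons (winv u) (inv_letter a).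
Proof. by rewrite -cat1s winv_cat cats1. Qed.

Lemma winv_rcons a u : winv (rcons u a) = inv_letter a :: winv u.
Proof. by rewrite -cats1 winv_cat. Qed.

Definition clean i u := (u == [::]) || ((last (i, false) u).1 != i).

Lemma clean_rcons i u a : clean i (rcons u a) = (a.1 != i).
Proof. by rewrite /clean last_rcons; case: u. Qed.

Lemma reduced_rcons_clean i e u : reduced u -> clean i u -> reduced (rcons u (i, e)).
Proof.
case/lastP: u => // u a; rewrite clean_rcons reduced_rcons2 => -> /= ai.
exact: nocancel_idx.
Qed.

Lemma reduced_conj i e u : reduced u -> clean i u -> reduced (u ++ (i, e) :: winv u).
Proof.
move=> ru cu; rewrite reduced_cat_cons reduced_rcons_clean // andTb.
by rewrite -reduced_winv winv_cons winvK reduced_rcons_clean.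
Qed.

Definition cj u i : fgroup n := cls u * fgen i * (cls u)^-1.

Lemma cjE u i : cj u i = cls (u ++ (i, false) :: winv u).
Proof. by rewrite cls_cat cls_cons cls_winv mulgA. Qed.

Lemma len_cj_le u i : len (cj u i) <= (size u).*2.+1.
Proof. by rewrite cjE; apply: leq_trans (len_cls _) _; rewrite size_cat /= size_winv; lia. Qed.

Lemma val_cj u i : reduced u -> clean i u -> val (cj u i) = u ++ (i, false) :: winv u.
Proof. by move=> ru cu; rewrite cjE val_cls freduce_id ?reduced_conj. Qed.

Lemma len_cj u i : reduced u -> clean i u -> len (cj u i) = (size u).*2.+1.
Proof. by move=> ru cu; rewrite /len val_cj // size_cat /= size_winv; lia. Qed.

Lemma ell_cj u i : ell (cj u i) = 1%R.
Proof.
rewrite /cj !ellM ellV [X in (_ + X - _)%R]ell_cls /alg_len big_seq1 /=; lia.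
Qed.

(* Trailing powers of [x_j] commute with [x_j]. *)
Lemma strip_conj j p : reduced p -> exists p0,
  [/\ reduced p0, clean j p0, cj p0 j = cj p j &
      forall q a, prefix (rcons q a) p -> a.1 != j -> prefix (rcons q a) p0].
Proof.
elim/last_ind: p => [|p b IH] rp; first by exists [::].
have [bj|bj] := eqVneq b.1 j; last by exists (rcons p b); rewrite clean_rcons.
have [|p0 [r0 c0 e0 h0]] := IH; first by move: rp; rewrite -cats1 => /reduced_cat_l.
exists p0; split=> // [|q a].
  rewrite e0 -cats1 /cj cls_cat invMg !mulgA; congr (_ * _).
  have -> : cls [:: b] = (fgen j) ^+ (~~ b.2) * (fgen j)^-1 ^+ b.2 :> fgroup n.
    case: b bj {rp} => i [] /= ->; rewrite ?expg0 ?expg1 ?mulg1 ?mul1g //.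
  by case: (b.2) => /=; rewrite expg0 expg1 ?mulg1 ?mul1g ?invgK ?mulgVK ?mulgK.
rewrite -[rcons p b]cats1 => /prefixP[r]; case/lastP: r => [|r c].
  by rewrite cats0 cats1 => /rcons_inj[_ <-]; rewrite bj eqxx.
rewrite -rcons_cat cats1 => /rcons_inj[hp _] aj; apply: h0 => //.
by rewrite hp prefix_prefix.
Qed.

Fixpoint lcp u v : word n :=
  if (u, v) is (a :: u', b :: v') then if a == b then a :: lcp u' v' else [::] else [::].

Definition diverge u v : bool :=
  if (u, v) is (a :: _, b :: _) then a != b else true.

Lemma lcpP u v : exists u' v', [/\ u = lcp u v ++ u', v = lcp u v ++ v' & diverge u' v'].
Proof.
elim: u v => [|a u IH] [|b v] /=.
- by exists [::], [::].
- by exists [::], (b :: v).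
- by exists (a :: u), [::].
case: eqVneq => [->|ab]; last by exists (a :: u), (b :: v).
by have [u' [v' [eu ev h]]] := IH v; exists u', v'; rewrite !cat_cons -eu -ev.
Qed.

Lemma quot_word u v : reduced u -> reduced v -> exists c,
  [/\ cls c = (cls u)^-1 * cls v, reduced c,
      forall i e, clean i u -> ~~ prefix (rcons u (i, ~~ e)) v -> reduced ((i, e) :: c) &
      forall j e, clean j v -> ~~ prefix (rcons v (j, e)) u -> reduced (rcons c (j, e))].
Proof.
move=> ru rv; have [u' [v' []]] := lcpP u v; move: (lcp u v) => p eu ev d.
have half w w' : reduced (p ++ w) -> reduced (winv w ++ w') ->
    diverge w w' ->
    forall i e, clean i (p ++ w) -> ~~ prefix (rcons (p ++ w) (i, ~~ e)) (p ++ w') ->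
    reduced ((i, e) :: winv w ++ w').
  case/lastP: w => [|w a] rw rr dw i e cw.
    case: w' rr {dw} => [|b w'] //= rr; rewrite cats0.
    rewrite -cats1 prefix_catr // prefix_cons prefix0s andbT => bi.
    move: bi; rewrite eqxx /= => bi; apply/andP; split=> //.
    by rewrite /nocancel /= /inv_letter /= eq_sym.
  move=> _; move: cw rr; rewrite -rcons_cat clean_rcons winv_rcons => ai /= rr.
  apply/andP; split=> //.
  by case: (a) ai => k f; apply: contraNneq => -[->].
have rc : reduced (winv u' ++ v').
  case: u' eu d => [|a u'] eu d; first by apply: (@reduced_cat_r p); rewrite -ev.
  case: v' ev d => [|b v'] ev d.
    by rewrite cats0 reduced_winv; apply: (@reduced_cat_r p); rewrite -eu.
  rewrite reduced_cat_cons winv_cons reduced_rcons2 -winv_cons reduced_winv.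
  have -> : nocancel (inv_letter a) b by rewrite /nocancel /= inv_letterK eq_sym.
  rewrite andbT.
  by apply/andP; split; apply: (@reduced_cat_r p); rewrite -?eu -?ev.
exists (winv u' ++ v'); split=> //.
- by rewrite eu ev !cls_cat cls_winv invMg -!mulgA mulKg.
- by move=> i e; rewrite eu ev; apply: half; rewrite -?eu.
- move=> j e; rewrite ev {1}eu => cv npr.
  rewrite -reduced_winv winv_rcons winv_cat winvK.
  apply: half => //; first by rewrite -ev.
  + by rewrite -reduced_winv winv_cat winvK.
  + by case: (u') (v') d => [|a ?] [|b ?] //; rewrite /diverge eq_sym.
  + by rewrite negbK.
Qed.

Lemma gap_path u i v j :
  reduced u -> clean i u -> reduced v -> clean j v -> i != j ->
  let d1 := prefix (rcons u (i, true)) v in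
  let d2 := prefix (rcons v (j, false)) u in
  let c := (if d1 then fgen i else 1) * (cls u)^-1 * cls v * (if d2 then fgen j else 1) in
  reduced ((i, d1) :: rcons (val c) (j, d2)).
Proof.
move=> ru cu rv cv ij; cbv zeta.
case d1: (prefix _ v); case d2: (prefix _ u).
- by have := size_prefix d1; have := size_prefix d2; rewrite !size_rcons; lia.
- rewrite mulg1; case/prefixP: d1 => t vE.
  have rt : reduced ((i, true) :: t) by move: rv; rewrite vE cat_rcons => /reduced_cat_r.
  have -> : fgen i * (cls u)^-1 * cls v = cls t.
    rewrite vE -cats1 !cls_cat (cls_inv_letter (i, false)) -!mulgA mulKg.
    by rewrite -/(fgen i) mulVKg.
  rewrite val_cls (freduce_id (path_sorted rt)) /reduced /= rcons_path; apply/andP; split=> //.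
  apply: nocancel_idx; move: cv; rewrite vE cat_rcons /clean last_cat /=.
  by case: (u).
- rewrite mul1g; case/prefixP: d2 => t uE.
  have rt : reduced ((j, false) :: t) by move: ru; rewrite uE cat_rcons => /reduced_cat_r.
  have -> : (cls u)^-1 * cls v * fgen j = cls (winv t).
    rewrite uE -cats1 !cls_cat -/(fgen j) cls_winv !invMg -!mulgA.
    by rewrite mulKg mulVg mulg1.
  rewrite val_cls freduce_id ?reduced_winv; last exact: path_sorted rt.
  have -> : rcons (winv t) (j, true) = winv ((j, false) :: t) by rewrite winv_cons.
  rewrite -reduced_winv winv_cons winvK.
  rewrite /reduced /= rcons_path; apply/andP; split=> //.
  apply: nocancel_idx; move: cu; rewrite uE cat_rcons /clean last_cat /=.
  by case: (v).
- rewrite mul1g mulg1; have [c [<- rc ci cj]] := quot_word ru rv.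
  rewrite val_cls freduce_id //; apply: reduced_cons_rcons.
  + by move=> _; apply: nocancel_idx.
  + by apply: ci => //; apply/negbT.
  + by apply: cj => //; apply/negbT.
Qed.

(* A move that does not shorten the absorbed conjugate can be undone by a shortening one. *)
Lemma absorb_dichotomy u i v j e :
  reduced u -> clean i u -> reduced v -> i != j ->
  ~~ prefix (rcons u (i, ~~ e)) v ->
  exists v0, [/\ reduced v0, clean j v0, prefix (rcons u (i, e)) v0 &
    cj v0 j = cls (u ++ (i, e) :: winv u) * cj v j * (cls (u ++ (i, e) :: winv u))^-1].
Proof.
move=> ru cu rv ij npr; have [c [ec rc ci _]] := quot_word ru rv.
have rp : reduced (u ++ (i, e) :: c) by rewrite reduced_cat_cons reduced_rcons_clean // ci.
have [v0 [r0 c0 e0 h0]] := strip_conj j rp.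
exists v0; split=> //; first by apply: h0 => //; rewrite -cat_rcons prefix_prefix.
rewrite e0 /cj -[(i, e) :: c]cat1s -[(i, e) :: winv u]cat1s !cls_cat ec cls_winv.
by rewrite !invMg !mulgA.
Qed.

End Conjugates.

(** * Cyclically reduced words *)

Section Cyclic.
Local Open Scope group_scope.

Lemma fcycle_ordS n : fcycle (@ordS n) (enum 'I_n).
Proof.
case en: (enum 'I_n) => [|i s] //; rewrite /path.cycle.
have sz : size (i :: s) = n by rewrite -en size_enum_ord.
have nthE k : k <= n -> nth i (i :: rcons s i) k = k %% n :> nat.
  rewrite -rcons_cons nth_rcons sz leq_eqVlt => /orP[/eqP->|kn].
    rewrite ltnn eqxx modnn.
    by have := @nth_enum_ord n i 0; rewrite en /= => ->; rewrite // -sz.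
  by rewrite kn -en nth_enum_ord // modn_small.
apply/(pathP i) => k; rewrite size_rcons -[(size s).+1]/(size (i :: s)) sz => kn.
have := nthE k.+1 kn; rewrite /= => e1.
by apply/eqP/val_inj; rewrite /= e1 nthE ?(ltnW kn) // (modn_small kn).
Qed.

Lemma prod_telescope (G : groupType) (T : eqType) (f : T -> T) (t w : T -> G) i s :
  fcycle f (i :: s) ->
  \prod_(k <- i :: s) ((t k)^-1 * w k * t (f k)) = (t i)^-1 * (\prod_(k <- i :: s) w k) * t i.
Proof.
suff gen j : path (frel f) i (rcons s j) ->
    \prod_(k <- i :: s) ((t k)^-1 * w k * t (f k)) = (t i)^-1 * (\prod_(k <- i :: s) w k) * t j.
  exact: gen.
elim: s i => [|k s IH] i /=.
  by rewrite andbT !big_seq1 => /eqP <-.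
by case/andP=> /eqP fi /IH; rewrite !(big_cons _ _ i) => ->; rewrite fi !mulgA mulgK.
Qed.

Lemma cycle_flatten n (T : Type) (L : T -> letter n) (g : T -> word n) (s : seq T) :
  path.cycle (fun i j => reduced (L i :: rcons (g i) (L j))) s ->
  path.cycle (@nocancel n) (flatten [seq L i :: g i | i <- s]).
Proof.
case: s => [|i s] //=; rewrite rcons_cat.
suff gen j : path (fun i j => reduced (L i :: rcons (g i) (L j))) i (rcons s j) ->
    path (@nocancel n) (L i) (g i ++ rcons (flatten [seq L i :: g i | i <- s]) (L j)).
  exact: gen.
elim: s i => [|k s IH] i /=; first by rewrite andbT cats1.
case/andP=> h /IH h'; rewrite rcons_cat -cat_rcons cat_path last_rcons.
exact/andP.
Qed.

Variable n : nat.
Implicit Types (a b : letter n) (C h : word n).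

Lemma size_prod_gens : size (prod_gens n) = n.
Proof. by rewrite size_map size_enum_ord. Qed.

Lemma prod_gens_pos a : a \in prod_gens n -> a.2 = false.
Proof. by case/mapP=> i _ ->. Qed.

Lemma pos_reduced (w : word n) : {in w, forall a, a.2 = false} -> reduced w.
Proof.
elim: w => // a [|b w] IH // pos; apply/andP; split; last first.
  by apply: IH => c cw; apply: pos; rewrite inE cw orbT.
apply/eqP => ba; have := pos b; rewrite !inE eqxx orbT => /(_ isT).
by rewrite ba /= (pos a) ?inE ?eqxx.
Qed.

Lemma reduced_prod_gens : reduced (prod_gens n).
Proof. by apply: pos_reduced => a; apply: prod_gens_pos. Qed.

Lemma cycle_reduced C : path.cycle (@nocancel n) C -> reduced C.
Proof. by case: C => //= a C; rewrite rcons_path => /andP[]. Qed.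

(* Each induction step cancels one letter of the conjugator [h] against [C], which rotates [C]
   by one place; the sign of that letter is the direction of the rotation. *)
Lemma conj_prod_gens C h : C != [::] -> path.cycle (@nocancel n) C -> reduced h ->
  cls h * cls C * (cls h)^-1 = cls (prod_gens n) ->
  exists k, [/\ k <= n, C = rot k (prod_gens n) & exists z : int, alg_len h = (k%:Z + n%:Z * z)%R].
Proof.
elim/last_ind: h C => [|h a IH] C nC cC rh.
  rewrite cls_nil mul1g invg1 mulg1 => /reduced_cls_inj -> //; last first.
  - exact: reduced_prod_gens.
  - exact: cycle_reduced.
  by exists 0; rewrite rot0; split=> //; exists 0%R; rewrite /alg_len big_nil; lia.
have rh' : reduced h by move: rh; rewrite -cats1 => /reduced_cat_l.
have eh D : cls (rcons h a) * D * (cls (rcons h a))^-1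
          = cls h * (cls [:: a] * D * (cls [:: a])^-1) * (cls h)^-1.
  by rewrite -cats1 cls_cat invMg !mulgA.
case: C nC cC => // c C _ cC; have [ca|ca] := eqVneq c (inv_letter a).
  have n0 : 0 < n by case: (c) => [[m mn] ?]; apply: leq_ltn_trans mn.
  rewrite eh (cls_cons c) ca cls_inv_letter mulVKg -cls_inv_letter -cls_cat cats1 -ca => e.
  have [||k [kn eC [z ez]]] := IH (rcons C c) _ _ rh' e.
  - by case: (C).
  - by rewrite -cats1 cycle_catC.
  have ecC : c :: C = rot n.-1 (rot k (prod_gens n)).
    have := congr1 size eC; rewrite size_rot size_prod_gens size_rcons => szC.
    have -> : n.-1 = size C by move: szC; lia.
    by rewrite -eC -cats1 rot_size_cat.
  have cpos : c.2 = false by apply: prod_gens_pos; rewrite -(mem_rot k) -eC mem_rcons !inE eqxx.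
  have apos : a.2 = true by move: cpos; rewrite ca /=; case: (a.2).
  move: ecC; rewrite rot_add_mod ?size_prod_gens //; last by lia.
  case: ifP => hk eC'.
    exists (n.-1 + k); split=> //; exists (z - 1)%R.
    by rewrite -cats1 alg_len_cat ez /alg_len big_seq1 apos; lia.
  exists (n.-1 + k - n); split=> //; first by lia.
  by exists z; rewrite -cats1 alg_len_cat ez /alg_len big_seq1 apos; lia.
have n0 : 0 < n by case: (c) => [[m mn] ?]; apply: leq_ltn_trans mn.
have [C' [d eC]] : exists C' d, c :: C = rcons C' d.
  by exists (belast c C), (last c C); rewrite lastI.
have [da|da] := eqVneq a d.
  have -> : cls (rcons h a) * cls (c :: C) * (cls (rcons h a))^-1 =
            cls h * cls (a :: C') * (cls h)^-1.
    rewrite eh eC -da -cats1 (cls_cons a C') (cls_cat C'); congr (_ * _ * _).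
    by rewrite mulgA mulgK.
  move=> e.
  have [||k [kn eC1 [z ez]]] := IH (a :: C') _ _ rh' e => //.
    by rewrite -cat1s path.cycle_catC cats1 da -eC.
  have apos : a.2 = false by apply: prod_gens_pos; rewrite -(mem_rot k) -eC1 inE eqxx.
  have : c :: C = rot 1 (rot k (prod_gens n)) by rewrite -eC1 rot1_cons eC da.
  rewrite rot_add_mod ?size_prod_gens //; case: ifP => hk eC'.
    exists (1 + k); split=> //; exists z.
    by rewrite -cats1 alg_len_cat ez /alg_len big_seq1 apos; lia.
  exists (1 + k - n); split=> //; first by lia.
  by exists (z + 1)%R; rewrite -cats1 alg_len_cat ez /alg_len big_seq1 apos; lia.
have rhC : reduced (rcons h a ++ c :: C).
  by rewrite reduced_cat_cons reduced_rcons2 rh [nocancel _ _]ca; apply: cycle_reduced.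
have rall : reduced ((rcons h a ++ c :: C) ++ winv (rcons h a)).
  rewrite eC -rcons_cat cat_rcons winv_rcons reduced_cat_cons rcons_cat -eC rhC andTb.
  apply/andP; split; first by apply: contraNneq da => /(inv_inj (@inv_letterK n)) ->.
  by change (reduced (inv_letter a :: winv h)); rewrite -winv_rcons reduced_winv.
rewrite -cls_winv -!cls_cat => /(reduced_cls_inj rall reduced_prod_gens) e.
have /prod_gens_pos : a \in prod_gens n by rewrite -e !mem_cat mem_rcons !inE eqxx.
have /prod_gens_pos : inv_letter a \in prod_gens n.
  by rewrite -e winv_rcons !mem_cat !inE eqxx !orbT.
by rewrite /=; case: (a.2).
Qed.

End Cyclic.

(** * Hurwitz moves *)

Section Moves.
Variable n : nat.
Implicit Types (i j k p q : 'I_n) (e : bool) (a m : 'I_n * bool).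
Local Open Scope group_scope.

Definition sgn e (g : fgroup n) := if e then g^-1 else g.

Lemma sgnK e g : sgn (~~ e) g = (sgn e g)^-1.
Proof. by case: e => //=; rewrite invgK. Qed.

Lemma sgn_conj e (g h : fgroup n) : sgn e (h * g * h^-1) = h * sgn e g * h^-1.
Proof. by case: e => //=; rewrite !invMg invgK mulgA. Qed.

Lemma sgn_x e i : sgn e (fgen i) = cls [:: (i, e)].
Proof. by case: e => //; rewrite -(cls_inv_letter (i, false)). Qed.

Lemma sgn_cj e (u : word n) i : sgn e (cj u i) = cls (u ++ (i, e) :: winv u).
Proof. by rewrite sgn_conj sgn_x -cls_winv -!cls_cat -catA. Qed.

Lemma conj_absorb (u t : word n) i j e :
  sgn e (cj u i) * cj (rcons u (i, ~~ e) ++ t) j * (sgn e (cj u i))^-1 = cj (u ++ t) j.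
Proof.
rewrite /cj -cats1 !cls_cat -[(i, ~~ e)]/(inv_letter (i, e)) cls_inv_letter -sgn_x.
by rewrite sgn_conj !invMg !invgK !mulgA !mulgVK !mulgK.
Qed.

Lemma conj_shorten (u : word n) i v j e : reduced v -> clean j v -> prefix (rcons u (i, ~~ e)) v ->
  len (sgn e (cj u i) * cj v j * (sgn e (cj u i))^-1) < len (cj v j).
Proof.
move=> rv cv /prefixP[t vE]; rewrite (len_cj rv cv) {1}vE conj_absorb.
by apply: leq_ltn_trans (len_cj_le _ _) _; rewrite vE !size_cat size_rcons; lia.
Qed.

Lemma conj_shortenP (u : word n) i v j e :
  reduced u -> clean i u -> reduced v -> clean j v -> i != j ->
  (if prefix (rcons u (i, ~~ e)) v then
     len (sgn e (cj u i) * cj v j * (sgn e (cj u i))^-1) < len (cj v j)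
   else len (cj v j) < len (sgn e (cj u i) * cj v j * (sgn e (cj u i))^-1)).
Proof.
move=> ru cu rv cv ij; case: ifPn => pr; first exact: conj_shorten.
have [v0 [r0 c0 p0]] := absorb_dichotomy ru cu rv ij pr.
rewrite -sgn_cj => e0; rewrite -e0.
have := @conj_shorten u i v0 j (~~ e) r0 c0; rewrite negbK => /(_ p0).
by rewrite sgnK invgK e0 !mulgA mulVg mul1g mulgVK.
Qed.

Definition ftuple := {ffun 'I_n -> fgroup n}.
Implicit Type V : ftuple.

Definition hmove e p q V : ftuple :=
  [ffun k => if k == p then sgn e (V p) * V q * (sgn e (V p))^-1
             else if k == q then V p else V k].

(* [sigma_i] turns [(w_i, w_{i+1})] into [(w_i w_{i+1} w_i^-1, w_i)]: entry [i] absorbs entry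
   [i+1]; for [sigma_i^-1] entry [i+1] absorbs entry [i]. *)
Definition absorber a := if a.2 then ordS a.1 else a.1.
Definition absorbed a := if a.2 then a.1 else ordS a.1.
Definition step V a := hmove a.2 (absorber a) (absorbed a) V.
Definition inv_move a : 'I_n * bool := (a.1, ~~ a.2).
(* The other move with the same absorber. *)
Definition opp_move a := if a.2 then (ordS a.1, false) else (ord_pred a.1, true).

Lemma hmoveK e p q : p != q -> cancel (hmove e p q) (hmove (~~ e) q p).
Proof.
move=> pq V; apply/ffunP => k; rewrite !ffunE !eqxx [q == p]eq_sym (negbTE pq) sgnK invgK.
by case: eqVneq => [->|_]; [rewrite !mulgA mulVg mul1g mulgVK | case: eqVneq => [->|]].
Qed.

Definition weight V := \sum_k len (V k).

Lemma weight_hmove e p q V : p != q ->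
  weight (hmove e p q V) + len (V q) = weight V + len (sgn e (V p) * V q * (sgn e (V p))^-1).
Proof.
move=> pq; rewrite /weight (bigD1 p) // (bigD1 q) 1?eq_sym //=.
rewrite [in RHS](bigD1 p) // [in RHS](bigD1 q) 1?eq_sym //=.
rewrite !ffunE !eqxx [q == p]eq_sym (negbTE pq).
rewrite [in LHS](eq_bigr (fun k => len (V k))); last first.
  by move=> k /andP[kp kq]; rewrite ffunE (negbTE kp) (negbTE kq).
by lia.
Qed.

Hypothesis n_gt1 : 1 < n.

Lemma ordS_neq i : ordS i != i.
Proof.
case: i => i lt_in; apply/eqP => /(congr1 val) /=.
have [e|ne] := eqVneq i.+1 n; first by rewrite e modnn => i0; move: n_gt1; lia.
by rewrite modn_small => [|]; lia.
Qed.

Lemma absorber_neq a : absorber a != absorbed a.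
Proof. by case: a => i [] /=; rewrite /absorber /absorbed /= ?ordS_neq // eq_sym ordS_neq. Qed.

Lemma step_inv V a : step (step V a) (inv_move a) = V.
Proof.
rewrite /step; have -> : absorber (inv_move a) = absorbed a.
  by rewrite /absorber /absorbed /=; case: (a.2).
have -> : absorbed (inv_move a) = absorber a by rewrite /absorber /absorbed /=; case: (a.2).
exact/hmoveK/absorber_neq.
Qed.

Definition rep V (u : 'I_n -> word n) (pi : 'I_n -> 'I_n) :=
  [/\ injective pi, forall k, reduced (u k), forall k, clean (pi k) (u k) &
      forall k, V k = cj (u k) (pi k)].

Definition reducing V a := weight (step V a) < weight V.

Lemma reducingE V (u : 'I_n -> word n) pi a : rep V u pi ->
  reducing V a = prefix (rcons (u (absorber a)) (pi (absorber a), ~~ a.2)) (u (absorbed a)).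
Proof.
move=> [ipi ru cu eV]; rewrite /reducing /step.
have := weight_hmove a.2 V (absorber_neq a).
have ne : pi (absorber a) != pi (absorbed a) by rewrite (inj_eq ipi) absorber_neq.
have := conj_shortenP a.2 (ru (absorber a)) (cu _) (ru (absorbed a)) (cu _) ne.
by rewrite !eV; case: ifP => _; lia.
Qed.

Lemma weight_step V (u : 'I_n -> word n) pi a :
  rep V u pi -> ~~ reducing V a -> weight V < weight (step V a).
Proof.
move=> rV; rewrite (reducingE _ rV); case: rV => [ipi ru cu eV] npr.
have := weight_hmove a.2 V (absorber_neq a).
have ne : pi (absorber a) != pi (absorbed a) by rewrite (inj_eq ipi) absorber_neq.
have := conj_shortenP a.2 (ru (absorber a)) (cu _) (ru (absorbed a)) (cu _) ne.
by rewrite !eV (negbTE npr) /step; lia.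
Qed.

Lemma rep_exists V (g : 'I_n -> fgroup n) (pi : 'I_n -> 'I_n) : injective pi ->
  (forall k, V k = g k * fgen (pi k) * (g k)^-1) -> exists u, rep V u pi.
Proof.
move=> ipi eV.
have /fin_all_exists[u hu] k : exists u, [/\ reduced u, clean (pi k) u & V k = cj u (pi k)].
  have [u [ru cu eu _]] := strip_conj (pi k) (valP (g k)).
  by exists u; split=> //; rewrite eu /cj clsK.
by exists u; split=> // k; have [] := hu k.
Qed.

Lemma rep_step V (u : 'I_n -> word n) pi a : rep V u pi -> exists u' pi', rep (step V a) u' pi'.
Proof.
move=> [ipi _ _ eV]; set p := absorber a; set q := absorbed a.
have pq : p != q := absorber_neq a.
have itp : injective (pi \o tperm p q) by exact: inj_comp perm_inj.
pose g k := if k == p then sgn a.2 (V p) * cls (u q) else if k == q then cls (u p) else cls (u k).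
have [|u' ru'] := @rep_exists (step V a) g _ itp; last by exists u', (pi \o tperm p q).
move=> k; rewrite /step /g ffunE /=; case: tpermP => [->|->|/eqP/negbTE-> /eqP/negbTE->].
- by rewrite eqxx eV invMg !mulgA [V q]eV /cj !mulgA.
- by rewrite [q == p]eq_sym (negbTE pq) eqxx eV.
- exact: eV.
Qed.

Definition prodV V := \prod_(k <- enum 'I_n) V k.
Definition delta : fgroup n := cls (prod_gens n).

Definition admissible V := (exists u pi, rep V u pi) /\
  (exists2 w, ell w = 0%R & prodV V = w * delta * w^-1).

Lemma prodV_telescope V (t : 'I_n -> fgroup n) k0 : exists i,
  \prod_(k <- enum 'I_n) ((t k)^-1 * V k * t (ordS k)) = (t i)^-1 * prodV V * t i.
Proof.
rewrite /prodV; have := fcycle_ordS n; case en : (enum 'I_n) => [|i s] h; last first.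
  by exists i; apply: prod_telescope.
by have := mem_enum 'I_n k0; rewrite en.
Qed.

Lemma ell_rep V (u : 'I_n -> word n) pi k : rep V u pi -> ell (V k) = 1%R.
Proof. by case=> _ _ _ ->; exact: ell_cj. Qed.

Lemma admissible_step V a : admissible V -> admissible (step V a).
Proof.
case=> [[u [pi rV]] [w w0 ew]]; split; first exact: rep_step rV.
pose i := a.1; pose s := if a.2 then (V i)^-1 * V (ordS i) else V (ordS i) * (V i)^-1.
pose t k := if k == ordS i then s else 1.
have s0 : ell s = 0%R by rewrite /s; case: ifP => _; rewrite ellM ellV !(ell_rep _ rV); lia.
have [j ej] := prodV_telescope V t i.
exists ((t j)^-1 * w); first by rewrite ellM ellV w0 /t; case: ifP; rewrite ?s0 ?ell1.
rewrite !invMg !invgK !mulgA -(mulgA _ w) -(mulgA _ _ w^-1) -ew -ej /prodV.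
apply: eq_bigr => k _; rewrite /step ffunE /absorber /absorbed /t /s -/i.
rewrite (inj_eq (can_inj (@ordSK n))).
have Si := ordS_neq i; have iS : i != ordS i by rewrite eq_sym.
case: (eqVneq k i) => [->|ki].
  rewrite (negbTE iS); case: (a.2); rewrite ?eqxx ?(negbTE iS) invg1 mul1g /=.
    by rewrite mulVKg.
  by rewrite mulgA.
case: (eqVneq k (ordS i)) => [->|kSi].
  by case: (a.2); rewrite ?eqxx ?(negbTE Si) mulg1 /= !invMg !invgK // ?mulgVK // -mulgA.
by case: (a.2); rewrite invg1 mul1g mulg1 ?(negbTE ki) ?(negbTE kSi).
Qed.

Definition std_tuple : ftuple := [ffun k => fgen k].

End Moves.

(** * Tuples without one-sided shortening *)

Section Terminal.
Variable n : nat.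
Hypothesis n_gt1 : 1 < n.
Implicit Types (i j k p q : 'I_n) (e : bool) (a m : 'I_n * bool) (V : ftuple n).
Local Open Scope group_scope.

Lemma ordS_const (T : Type) (f : 'I_n -> T) : (forall i, f (ordS i) = f i) -> forall i j, f i = f j.
Proof.
move=> fS; have n0 : 0 < n by apply: ltnW.
suff f0 (k : nat) (kn : k < n) : f (Ordinal kn) = f (Ordinal n0).
  by move=> [i hi] [j hj]; rewrite (f0 _ hi) (f0 _ hj).
elim: k kn => [|k IH] kn; first by congr f; apply: val_inj.
rewrite -(IH (ltnW kn)) -[RHS]fS; congr f; apply: val_inj => /=.
by rewrite modn_small.
Qed.

Lemma opp_moveK : involutive (@opp_move n).
Proof. by case=> i [] /=; rewrite /opp_move /= ?ordSK ?ord_predK. Qed.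

Section NoSingle.
Variables (V : ftuple n) (u : 'I_n -> word n) (pi : 'I_n -> 'I_n).
Hypothesis rV : rep V u pi.
Hypothesis noS : forall m, reducing V m -> reducing V (opp_move m).

Let D i := reducing V (i, false).
(* Writing [x = x x^-1 x] at each entry that shortens both neighbours, the outer factors are
   absorbed into the gaps [y_i u_i^-1 u_{i+1} y_{i+1}]. *)
Let y i : fgroup n := if D i then fgen (pi i) else 1.
Let t i : fgroup n := cls (u i) * y i.
Let gap i : word n := val (y i * (cls (u i))^-1 * cls (u (ordS i)) * y (ordS i)).
Let C := flatten [seq (pi i, D i) :: gap i | i <- enum 'I_n].

Lemma absorbs_ordS i : D (ordS i) = prefix (rcons (u (ordS i)) (pi (ordS i), false)) (u i).
Proof.
rewrite -(reducingE n_gt1 (i, true) rV) /D; apply/idP/idP; last exact: noS.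
by move/noS; rewrite /opp_move /= ordSK.
Qed.

Lemma cycle_gap_word : path.cycle (@nocancel n) C.
Proof.
apply: cycle_flatten; case: rV => ipi ru cu _.
have h i : reduced ((pi i, D i) :: rcons (gap i) (pi (ordS i), D (ordS i))).
  rewrite /gap /y absorbs_ordS /D (reducingE n_gt1 (i, false) rV).
  by apply: gap_path => //; rewrite (inj_eq ipi) eq_sym ordS_neq.
by apply: sub_cycle (fcycle_ordS n) => i _ /eqP <-.
Qed.

Lemma cls_gap_word i0 : exists i, cls C = (t i)^-1 * prodV V * t i.
Proof.
have [i e] := prodV_telescope V t i0; exists i; rewrite -e {e}.
rewrite cls_flatten; apply: eq_bigr => k _.
rewrite cls_cons clsK /t; case: rV => _ _ _ ->; rewrite /cj.
have -> : cls [:: (pi k, D k)] = (y k)^-1 * fgen (pi k) * (y k)^-1.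
  rewrite /y; case: (D k); last by rewrite invg1 mul1g mulg1.
  by rewrite mulVg mul1g -(cls_inv_letter (_, false)).
by rewrite !invMg !mulgA !mulgVK.
Qed.

Lemma no_single_std w : ell w = 0%R -> prodV V = w * delta n * w^-1 -> V = std_tuple n.
Proof.
move=> w0 eP; have n0 : 0 < n by apply: ltnW.
have [i0 eC] := cls_gap_word (Ordinal n0).
have enum_n : 0 < size (enum 'I_n) by rewrite size_enum_ord.
have nC : C != [::] by rewrite /C; case: (enum 'I_n) enum_n.
pose h := (w^-1 * t i0).
have [|k [kn eCk [z ez]]] := conj_prod_gens nC cycle_gap_word (valP h).
  rewrite clsK eC eP /h !invMg !invgK !mulgA !mulgK.
  by rewrite mulgVK mulVg mul1g.
have letC i a : a \in (pi i, D i) :: gap i -> a \in C.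
  move=> ai; apply/flattenP; exists ((pi i, D i) :: gap i) => //.
  by apply/mapP; exists i; rewrite ?mem_enum.
have D0 i : D i = false.
  by apply: (@prod_gens_pos n (pi i, D i)); rewrite -(mem_rot k) -eCk (letC i) // inE eqxx.
have sC : size C = n by rewrite eCk size_rot size_prod_gens.
have gap0 i : gap i = [::].
  move: sC; rewrite /C size_flatten /shape -map_comp sumnE big_map big_enum /=.
  rewrite (eq_bigr (fun i => 1 + size (gap i))) // big_split /= sum1_card card_ord.
  rewrite -[RHS]addn0 => /addnI/eqP; rewrite sum_nat_eq0 => /forallP/(_ i)/eqP.
  exact: size0nil.
have [ipi ru cu eV] := rV.
have uS i : u (ordS i) = u i.
  have := gap0 i; rewrite /gap /y !D0 mul1g mulg1 => /(congr1 (@cls n)).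
  rewrite clsK cls_nil => /mulg1_eq; rewrite invgK => e.
  by apply: reduced_cls_inj.
have u0 i : u i = [::].
  case/lastP eu: (u i) => [//|s a].
  have [k' kk'] : exists k', pi k' = a.1.
    by have [g _ gK] := injF_bij ipi; exists (g a.1).
  by have := cu k'; rewrite (ordS_const uS k' i) eu clean_rcons kk' eqxx.
have : C = prod_gens n.
  have : ell h = 0%R by rewrite /h /t /y u0 D0 ellM ellV w0 cls_nil mulg1 ell1.
  rewrite /ell ez => ek; rewrite eCk.
  have [->|->] : k = 0 \/ k = n.
    case: z {ez} ek => m ek; [left | right]; first by nia.
    have : k = (n * m.+1)%N by rewrite NegzE in ek; nia.
    by rewrite mulnS; move: kn; case: (n * m)%N => [|?]; lia.
    by rewrite rot0.
  by rewrite -[X in rot X]size_prod_gens rot_size.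
rewrite /C.
have -> : [seq (pi i, D i) :: gap i | i <- enum 'I_n] = [seq [:: (pi i, false)] | i <- enum 'I_n].
  by apply: eq_map => i; rewrite D0 gap0.
have -> s : flatten [seq [:: (pi i, false)] | i <- s] = [seq (pi i, false) | i <- s].
  by elim: s => //= i s ->.
move/eq_in_map => e; apply/ffunP => i; rewrite ffunE eV u0.
have [->] := e i (mem_enum _ _).
by rewrite /cj cls_nil mul1g invg1 mulg1.
Qed.

End NoSingle.

Lemma single_absorber V : admissible V -> V = std_tuple n \/
  exists m, reducing V m && ~~ reducing V (opp_move m).
Proof.
case=> [[u [pi rV]] [w w0 eP]].
case: (pickP (fun m => reducing V m && ~~ reducing V (opp_move m))) => [m hm|none]; [right|left].
  by exists m.
apply: (no_single_std rV) w0 eP => m rm.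
by have := none m; rewrite /= rm => /negbFE.
Qed.

End Terminal.

(** * Resolving pairs of shortening moves *)

Section BraidWords.
Variable n : nat.
Implicit Types (b c d : bword n) (a : 'I_n * bool) (i j : 'I_n).

Lemma bequiv_catl b c d : bequiv c d -> bequiv (b ++ c) (b ++ d).
Proof. by move=> h; apply: be_cat => //; apply: be_refl. Qed.

Lemma bequiv_catr b c d : bequiv c d -> bequiv (c ++ b) (d ++ b).
Proof. by move=> h; apply: be_cat => //; apply: be_refl. Qed.

Lemma bequiv_winvr b : bequiv (b ++ winv b) [::].
Proof.
elim: b => [|a b IH]; first exact: be_refl.
rewrite winv_cons -rcons_cat -cats1; apply: be_trans (be_free a).
exact: (bequiv_catl [:: a] (bequiv_catr [:: inv_letter a] IH)).
Qed.

Lemma bequiv_winvl b : bequiv (winv b ++ b) [::].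
Proof. by rewrite -{2}[b]winvK; apply: bequiv_winvr. Qed.

Lemma bequiv_winv b c : bequiv b c -> bequiv (winv b) (winv c).
Proof.
move=> bc; apply: be_trans (_ : bequiv (winv b ++ c ++ winv c) _).
  by rewrite -{1}[winv b]cats0; apply/bequiv_catl/be_sym/bequiv_winvr.
rewrite -{2}[winv c]cat0s catA; apply: bequiv_catr; apply: be_trans (bequiv_winvl b).
by apply/bequiv_catl/be_sym.
Qed.

Lemma bequiv_comm_winv b c : bequiv (b ++ c) (c ++ b) -> bequiv (winv b ++ c) (c ++ winv b).
Proof.
move=> h; apply: be_trans (_ : bequiv (winv b ++ (b ++ c) ++ winv b) _).
  apply: be_trans (_ : bequiv (winv b ++ (c ++ b) ++ winv b) _); last first.
    by apply/bequiv_catl/bequiv_catr/be_sym.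
  apply: bequiv_catl; rewrite -catA -{1}[c]cats0; exact/bequiv_catl/be_sym/bequiv_winvr.
rewrite -!catA (catA (winv b) b); apply: (bequiv_catr _ (bequiv_winvl b)).
Qed.

Lemma bequiv_comm i j e f : j != ordS i -> i != ordS j ->
  bequiv [:: (i, e); (j, f)] [:: (j, f); (i, e)].
Proof.
move=> ji ij; have h := be_comm ji ij.
have {}h : bequiv [:: (i, e); (j, false)] [:: (j, false); (i, e)].
  by case: e => //; apply: (@bequiv_comm_winv [:: (i, false)] [:: (j, false)]).
case: f => //; apply: be_sym.
by apply: (@bequiv_comm_winv [:: (j, false)] [:: (i, e)]); apply: be_sym.
Qed.

Lemma bequiv_chain i j e : (j == ordS i) || (i == ordS j) ->
  bequiv [:: (i, e); (j, e); (i, e)] [:: (j, e); (i, e); (j, e)].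
Proof.
move=> ij; have h : bequiv [:: (i, false); (j, false); (i, false)]
                            [:: (j, false); (i, false); (j, false)].
  by case/orP: ij => /eqP ->; [|apply: be_sym]; apply: be_braid.
by case: e => //; apply: (bequiv_winv h).
Qed.

Lemma bequiv_fork i j e : (j == ordS i) || (i == ordS j) ->
  bequiv [:: (i, e); (j, e); (i, ~~ e)] [:: (j, ~~ e); (i, e); (j, e)].
Proof.
move=> ij; have h := bequiv_chain e ij.
apply: be_trans (_ : bequiv ([:: (j, ~~ e)] ++ [:: (j, e); (i, e); (j, e)] ++ [:: (i, ~~ e)]) _).
  apply: be_sym.
  exact: (bequiv_catr [:: (i, e); (j, e); (i, ~~ e)] (bequiv_winvl [:: (j, e)])).
apply: be_trans (_ : bequiv ([:: (j, ~~ e)] ++ [:: (i, e); (j, e); (i, e)] ++ [:: (i, ~~ e)]) _).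
  by apply/bequiv_catl/bequiv_catr/be_sym.
exact: (bequiv_catl [:: (j, ~~ e); (i, e); (j, e)] (bequiv_winvr [:: (i, e)])).
Qed.

End BraidWords.

Section Peaks.
Variable n : nat.
Implicit Types (i j k p q r : 'I_n) (e : bool) (a m : 'I_n * bool) (V : ftuple n) (b : bword n).
Local Open Scope group_scope.

Definition walk V b : ftuple n := foldl (@step n) V b.

Fixpoint below N V b : bool :=
  (weight V < N) && (if b is a :: b' then below N (step V a) b' else true).

(* Local confluence in Newman's sense, the weight being the termination measure. *)
Definition peak V a m := exists b c,
  [/\ bequiv (a :: b) (m :: c), walk V (a :: b) = walk V (m :: c),
      below (weight V) (step V a) b & below (weight V) (step V m) c].

Lemma peak_sym V a m : peak V a m -> peak V m a.
Proof.
by case=> b [c [h1 h2 h3 h4]]; exists c, b; split=> //; apply: be_sym.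
Qed.

Lemma weight_agree3 V V' p q r : p != q -> q != r -> p != r ->
  (forall k, k != p -> k != q -> k != r -> V' k = V k) ->
  weight V' + (len (V p) + len (V q) + len (V r)) =
  weight V + (len (V' p) + len (V' q) + len (V' r)).
Proof.
move=> pq qr pr eV.
have split3 W : weight W = len (W p) + (len (W q) + (len (W r) +
    \sum_(k | (k != p) && (k != q) && (k != r)) len (W k))).
  rewrite /weight (bigD1 p) // (bigD1 q) 1?eq_sym //= (bigD1 r) //=.
  by rewrite [r == p]eq_sym pr eq_sym qr.
have eS : \sum_(k | (k != p) && (k != q) && (k != r)) len (V' k) =
          \sum_(k | (k != p) && (k != q) && (k != r)) len (V k).
  by apply: eq_bigr => k /andP[/andP[kp kq] kr]; rewrite eV.
by rewrite !split3 eS; lia.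
Qed.

Lemma prefix_word (s t : word n) : prefix s t -> exists w : word n, t = s ++ w.
Proof. by case/prefixP=> w ->; exists w. Qed.

Section Triple.
Variables (e : bool) (p q r : 'I_n) (V : ftuple n).
Hypotheses (pq : p != q) (qr : q != r) (pr : p != r).

Let neqs : (((q == p) = false) * ((p == q) = false)) * (((q == r) = false) * ((r == q) = false))
  * (((p == r) = false) * ((r == p) = false)).
Proof.
by rewrite [q == p]eq_sym [r == q]eq_sym [r == p]eq_sym !(negbTE pq, negbTE qr, negbTE pr).
Qed.

Lemma hmove_braid :
  hmove e p q (hmove e q r (hmove e p q V)) = hmove e q r (hmove e p q (hmove e q r V)).
Proof.
apply/ffunP => k; rewrite !ffunE !eqxx !neqs.
have [ek|kp] := eqVneq k p; rewrite ?ek ?eqxx ?neqs.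
  by rewrite !sgn_conj !invMg !invgK !mulgA !mulgVK.
by case: (k == q); case: (k == r).
Qed.

Lemma hmove_fork :
  hmove (~~ e) q p (hmove e q r (hmove e p q V)) = hmove e q r (hmove e p q (hmove (~~ e) r q V)).
Proof.
apply/ffunP => k; rewrite !ffunE !eqxx !neqs.
have [ek|kq] := eqVneq k q; rewrite ?ek ?eqxx ?neqs.
  by rewrite !sgnK !sgn_conj !invMg !invgK !mulgA !mulgVK.
by case: (eqVneq k p) => [->|_]; rewrite ?neqs //; case: (k == r).
Qed.

Variables (u : 'I_n -> word n) (pi : 'I_n -> 'I_n).
Hypothesis rV : rep V u pi.

Let agree3 V' : (forall k, k != p -> k != q -> k != r -> V' k = V k) ->
  len (V' p) + len (V' q) + len (V' r) < (size (u p)).*2 + (size (u q)).*2 + (size (u r)).*2 + 3 ->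
  weight V' < weight V.
Proof.
case: rV => _ ru cu eV h; have := weight_agree3 pq qr pr h.
by rewrite !eV !len_cj //; lia.
Qed.

Lemma chain_lower :
  prefix (rcons (u p) (pi p, ~~ e)) (u q) -> prefix (rcons (u q) (pi q, ~~ e)) (u r) ->
  [/\ weight (hmove e p q V) < weight V,
      weight (hmove e q r (hmove e p q V)) < weight V,
      weight (hmove e p q (hmove e q r (hmove e p q V))) < weight V,
      weight (hmove e q r V) < weight V &
      weight (hmove e p q (hmove e q r V)) < weight V].
Proof.
case/prefix_word=> v uq /prefix_word[s ur]; have [_ ru cu eV] := rV.
have sq : size (u q) = (size (u p) + size v).+1 by rewrite uq size_cat size_rcons addSn.
have sr : size (u r) = (size (u p) + size v + size s).+2.
  by rewrite ur size_cat size_rcons sq; lia.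
have ur' : u r = rcons (u p) (pi p, ~~ e) ++ (rcons v (pi q, ~~ e) ++ s).
  by rewrite ur uq -!cats1 -!catA.
have c_pq : sgn e (V p) * V q * (sgn e (V p))^-1 = cj (u p ++ v) (pi q).
  by rewrite !eV uq conj_absorb.
have c_pr : sgn e (V p) * V r * (sgn e (V p))^-1 = cj (rcons (u p ++ v) (pi q, ~~ e) ++ s) (pi r).
  by rewrite !eV ur' conj_absorb -!cats1 -!catA.
have c_qr : sgn e (V q) * V r * (sgn e (V q))^-1 = cj (rcons (u p) (pi p, ~~ e) ++ (v ++ s)) (pi r).
  by rewrite !eV ur conj_absorb uq -!catA.
have l_p := len_cj (ru p) (cu p); have l_q := len_cj (ru q) (cu q).
have l_r := len_cj (ru r) (cu r).
have l_pq := len_cj_le (u p ++ v) (pi q).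
have l_pr := len_cj_le (rcons (u p ++ v) (pi q, ~~ e) ++ s) (pi r).
have l_qr := len_cj_le (rcons (u p) (pi p, ~~ e) ++ (v ++ s)) (pi r).
have l_pqr := len_cj_le (u p ++ (v ++ s)) (pi r).
rewrite !(size_cat, size_rcons) in l_pq l_pr l_qr l_pqr.
split; apply: agree3; try (by move=> k kp kq kr; rewrite !ffunE !(negbTE kp, negbTE kq, negbTE kr));
  rewrite !ffunE !eqxx !neqs ?c_pq ?c_pr ?c_qr ?conj_absorb ?(eV p) ?(eV q) ?(eV r);
  rewrite ?conj_absorb -?catA; lia.
Qed.

Lemma fork_lower :
  prefix (rcons (u p) (pi p, ~~ e)) (u r) -> prefix (rcons (u r) (pi r, e)) (u q) ->
  [/\ weight (hmove e p q V) < weight V,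
      weight (hmove e q r (hmove e p q V)) < weight V,
      weight (hmove (~~ e) q p (hmove e q r (hmove e p q V))) < weight V,
      weight (hmove (~~ e) r q V) < weight V &
      weight (hmove e p q (hmove (~~ e) r q V)) < weight V].
Proof.
case/prefix_word=> t ur /prefix_word[v uq]; have [_ ru cu eV] := rV.
have sr : size (u r) = (size (u p) + size t).+1 by rewrite ur size_cat size_rcons addSn.
have sq : size (u q) = (size (u p) + size t + size v).+2.
  by rewrite uq size_cat size_rcons sr; lia.
have uq' : u q = rcons (u p) (pi p, ~~ e) ++ (rcons t (pi r, e) ++ v).
  by rewrite uq ur -!cats1 -!catA.
have c_pq : sgn e (V p) * V q * (sgn e (V p))^-1 =
            cj (rcons (u p ++ t) (pi r, ~~ ~~ e) ++ v) (pi q).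
  by rewrite !eV uq' conj_absorb negbK -!cats1 -!catA.
have c_pr : sgn e (V p) * V r * (sgn e (V p))^-1 = cj (u p ++ t) (pi r).
  by rewrite !eV ur conj_absorb.
have c_rq : sgn (~~ e) (V r) * V q * (sgn (~~ e) (V r))^-1 = cj (u r ++ v) (pi q).
  by have := conj_absorb (u r) v (pi r) (pi q) (~~ e); rewrite negbK !eV uq.
have l_p := len_cj (ru p) (cu p); have l_q := len_cj (ru q) (cu q).
have l_r := len_cj (ru r) (cu r).
have l_pq := len_cj_le (rcons (u p ++ t) (pi r, ~~ ~~ e) ++ v) (pi q).
have l_pr := len_cj_le (u p ++ t) (pi r).
have l_rq := len_cj_le (u r ++ v) (pi q).
have l_pqr := len_cj_le ((u p ++ t) ++ v) (pi q).
rewrite !(size_cat, size_rcons) in l_pq l_pr l_rq l_pqr.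
split; apply: agree3; try (by move=> k kp kq kr; rewrite !ffunE !(negbTE kp, negbTE kq, negbTE kr));
  rewrite !ffunE !eqxx !neqs ?c_pq ?c_pr ?c_rq ?conj_absorb ?(eV p) ?(eV q) ?(eV r); lia.
Qed.

End Triple.
End Peaks.

(** * Descent *)

Section Confluence.
Variable n : nat.
Hypothesis n_gt1 : 1 < n.
Implicit Types (i j k p q r : 'I_n) (e : bool) (a m : 'I_n * bool) (V : ftuple n) (b : bword n).
Local Open Scope group_scope.

Lemma hmove_comm e f p q r s V : p != q -> r != s -> r != p -> r != q -> s != p -> s != q ->
  hmove f r s (hmove e p q V) = hmove e p q (hmove f r s V).
Proof.
move=> pq rs rp rq sp sq; apply/ffunP => k; rewrite !ffunE.
rewrite (negbTE rp) (negbTE rq) (negbTE sp) (negbTE sq).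
rewrite ![p == _]eq_sym ![q == _]eq_sym (negbTE rp) (negbTE rq) (negbTE sp) (negbTE sq).
case: (eqVneq k r) => [->|_]; first by rewrite (negbTE rp) (negbTE rq).
by case: (eqVneq k s) => [->|_]; first by rewrite (negbTE sp) (negbTE sq).
Qed.

Lemma peak_far V a m : absorber m != absorber a -> absorber m != absorbed a ->
  absorbed m != absorber a -> absorbed m != absorbed a ->
  bequiv [:: a; m] [:: m; a] -> reducing V a -> reducing V m -> peak V a m.
Proof.
move=> h1 h2 h3 h4 hb ra rm; have am := absorber_neq n_gt1 a; have mm := absorber_neq n_gt1 m.
have comm : step (step V a) m = step (step V m) a by apply: hmove_comm.
have lam : weight (step (step V a) m) < weight V.
  have := weight_hmove m.2 (step V a) mm; have := weight_hmove m.2 V mm.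
  rewrite -/(step (step V a) m) -/(step V m) ![step V a _]ffunE.
  rewrite (negbTE h1) (negbTE h2) (negbTE h3) (negbTE h4).
  by move: ra rm; rewrite /reducing; lia.
exists [:: m], [:: a]; split; rewrite //= -?comm ?lam ?andbT //.
Qed.

(* [p], [q], [r] are cyclically consecutive, in decreasing order if [e]. *)
Definition consec e p q r i1 i2 :=
  [/\ [/\ absorber (i1, e) = p, absorbed (i1, e) = q, absorber (i2, e) = q & absorbed (i2, e) = r],
      absorber (i1, ~~ e) = q, absorbed (i1, ~~ e) = p, absorber (i2, ~~ e) = r &
      absorbed (i2, ~~ e) = q].

Lemma consec_sym e p q r i1 i2 : consec e p q r i1 i2 -> consec (~~ e) r q p i2 i1.
Proof. by case=> -[? ? ? ?] ? ? ? ?; split; rewrite ?negbK. Qed.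

Lemma consec_neq e p q r i1 i2 : consec e p q r i1 i2 -> p != q /\ q != r.
Proof.
by case=> -[<- <- e2 <-] _ _ _ _; split; [|rewrite -e2]; apply: absorber_neq.
Qed.

Lemma consec_adj e p q r i1 i2 : consec e p q r i1 i2 -> (i2 == ordS i1) || (i1 == ordS i2).
Proof.
by case=> -[_ <- + _] _ _ _ _; case: e; rewrite /absorber /absorbed /= => ->; rewrite eqxx ?orbT.
Qed.

Lemma consec_ordS e i : consec e (if e then ordS (ordS i) else i) (ordS i)
  (if e then i else ordS (ordS i)) (if e then ordS i else i) (if e then i else ordS i).
Proof. by case: e. Qed.

Lemma peak_chain V u pi e p q r i1 i2 : consec e p q r i1 i2 -> rep V u pi ->
  reducing V (i1, e) -> reducing V (i2, e) -> peak V (i1, e) (i2, e).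
Proof.
move=> cs rV; rewrite !(reducingE n_gt1 _ rV).
have [pq qr] := consec_neq cs; have adj := consec_adj cs.
case: cs => -[/= a1 d1 a2 d2] _ _ _ _; rewrite a1 d1 a2 d2 => h1 h2.
have pr : p != r.
  by apply/eqP => pr; have := size_prefix h1; have := size_prefix h2; rewrite pr !size_rcons; lia.
have [l1 l2 l3 l4 l5] := chain_lower pq qr pr rV h1 h2.
have E := hmove_braid e V pq qr pr.
exists [:: (i2, e); (i1, e)], [:: (i1, e); (i2, e)]; rewrite /= /step /= a1 d1 a2 d2.
by rewrite l1 l2 l3 l4 l5 -E l3; split=> //; apply: bequiv_chain.
Qed.

Lemma peak_fork_lt V u pi e p q r i1 i2 :
  consec e p q r i1 i2 -> rep V u pi -> size (u p) <= size (u r) ->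
  reducing V (i1, e) -> reducing V (i2, ~~ e) -> peak V (i1, e) (i2, ~~ e).
Proof.
move=> cs rV sz; rewrite !(reducingE n_gt1 _ rV).
have [pq qr] := consec_neq cs; have adj := consec_adj cs.
case: cs => -[/= a1 d1 a2 d2] a1' d1' a2' d2'; rewrite a1 d1 a2' d2' negbK => h1 h2.
have h : prefix (rcons (u p) (pi p, ~~ e)) (rcons (u r) (pi r, e)).
  move: h1 h2; rewrite !prefixE => /eqP h1 /eqP h2.
  by rewrite -h2 take_takel ?h1 // !size_rcons ltnS.
have h' : prefix (rcons (u p) (pi p, ~~ e)) (u r).
  case/prefix_word: h => w; case/lastP: w => [|w c].
    by rewrite cats0 => /rcons_inj[_ _]; case: (e).
  rewrite -rcons_cat => /rcons_inj[-> _]; exact: prefix_prefix.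
have pr : p != r.
  by apply/eqP => pr; have := size_prefix h'; rewrite pr !size_rcons; lia.
have [l1 l2 l3 l4 l5] := fork_lower pq qr pr rV h' h2.
have E := hmove_fork e V pq qr pr.
exists [:: (i2, e); (i1, ~~ e)], [:: (i1, e); (i2, e)].
rewrite /= /step /= a1 d1 a2 d2 a1' d1' a2' d2'.
by rewrite l1 l2 l3 l4 l5 -E l3; split=> //; apply: bequiv_fork.
Qed.

Lemma peak_fork V u pi e p q r i1 i2 : consec e p q r i1 i2 -> rep V u pi ->
  reducing V (i1, e) -> reducing V (i2, ~~ e) -> peak V (i1, e) (i2, ~~ e).
Proof.
move=> cs rV h1 h2; case: (leqP (size (u p)) (size (u r))) => sz.
  exact: peak_fork_lt cs rV sz h1 h2.
apply: peak_sym; rewrite -{2}[e]negbK.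
by apply: (peak_fork_lt (consec_sym cs) rV (ltnW sz)) => //; rewrite negbK.
Qed.

Lemma peak_adj V u pi i e f : rep V u pi -> (ordS i, f) != opp_move (i, e) ->
  reducing V (i, e) -> reducing V (ordS i, f) -> peak V (i, e) (ordS i, f).
Proof.
move=> rV; case: e f => [] [] ne h1 h2.
- by apply/peak_sym/(peak_chain (consec_ordS true i) rV).
- by rewrite /opp_move eqxx in ne.
- exact: (peak_fork (consec_ordS false i) rV).
- exact: (peak_chain (consec_ordS false i) rV).
Qed.

Lemma peak_any V u pi a m : rep V u pi -> m != a -> m != opp_move a ->
  reducing V a -> reducing V m -> peak V a m.
Proof.
move=> rV; case: a m => i e [j f] ma mo ra rm.
have [ji|ji] := eqVneq j (ordS i).
  by subst j; apply: peak_adj rV mo ra rm.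
have [ij|ij] := eqVneq i (ordS j).
  subst i; apply/peak_sym/(peak_adj rV) => //.
  by apply: contraNneq mo => ->; rewrite opp_moveK.
have [e_ij|nij] := eqVneq i j.
  subst j; have ef : f = ~~ e by move: ma; case: (e) (f) => [] [] //; rewrite eqxx.
  move: ra rm; rewrite !(reducingE n_gt1 _ rV) ef /absorber /absorbed /=.
  by case: (e) => /= /size_prefix + /size_prefix; rewrite !size_rcons; lia.
apply: peak_far => //; last by apply: bequiv_comm.
all: rewrite /absorber /absorbed /=; case: (e); case: (f) => //=.
all: rewrite ?(inj_eq (can_inj (@ordSK n))) // eq_sym //.
Qed.

Lemma admissible_rep V : admissible V -> exists u pi, rep V u pi.
Proof. by case. Qed.

Lemma rep_std : rep (std_tuple n) (fun=> [::]) id.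
Proof. by split=> // k; rewrite ffunE /cj cls_nil mul1g invg1 mulg1. Qed.

Lemma admissible_std : admissible (std_tuple n).
Proof.
split; first by exists (fun=> [::]), id; apply: rep_std.
exists 1; rewrite ?ell1 // invg1 mul1g mulg1 /prodV /delta /prod_gens.
elim: (enum 'I_n) => [|i s IH]; first by rewrite big_nil.
by rewrite big_cons IH ffunE [RHS]cls_cons.
Qed.

Lemma std_not_reducing a : ~~ reducing (std_tuple n) a.
Proof. by rewrite (reducingE n_gt1 _ rep_std). Qed.

Lemma admissible_walk V b : admissible V -> admissible (walk V b).
Proof. by elim: b V => //= a b IH V gV; apply/IH/admissible_step. Qed.

Definition potential N (h : ftuple n -> bword n) := forall V a,
  admissible V -> weight V < N -> weight (step V a) < N -> bequiv (h V) (a :: h (step V a)).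

Lemma potential_walk N h V b : potential N h -> admissible V -> below N V b ->
  bequiv (h V) (b ++ h (walk V b)).
Proof.
move=> ph; elim: b V => [|a b IH] V gV /=; first by move=> _; apply: be_refl.
case/andP=> lV bV; have lV' : weight (step V a) < N by case: (b) bV => [|? ?] /= /andP[].
apply: be_trans (ph V a gV lV lV') _.
by apply: (bequiv_catl [:: a]); apply: IH => //; apply: admissible_step.
Qed.

Lemma potential_exists N : exists h, potential N h.
Proof.
elim: N => [|N [h ph]]; first by exists (fun=> [::]) => V a _; rewrite ltn0.
pose h' V := if weight V < N then h V else
  if [pick m | reducing V m && ~~ reducing V (opp_move m)] is Some m then m :: h (step V m)
  else [::].
have down V a : admissible V -> weight V < N.+1 -> reducing V a ->
    bequiv (h' V) (a :: h' (step V a)).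
  rewrite ltnS => gV lV ra; have lVa : weight (step V a) < N by apply: leq_trans lV.
  rewrite {2}/h' lVa /h'; case: ifP => lN; first exact: ph.
  have eN : weight V = N by apply/eqP; rewrite eqn_leq lV leqNgt lN.
  case: pickP => [m /andP[rm nrm]|none]; last first.
    case: (single_absorber n_gt1 gV) => [eV|[m]]; last by rewrite none.
    by move: ra; rewrite eV (negbTE (std_not_reducing a)).
  have [->|ma] := eqVneq m a; first exact: be_refl.
  have [u [pi rV]] := admissible_rep gV.
  have mo : m != opp_move a by apply: contraNneq nrm => ->; rewrite opp_moveK.
  have [b [c [bc wbc lb lc]]] := peak_any rV ma mo ra rm.
  rewrite eN in lb lc.
  have hb := potential_walk ph (admissible_step n_gt1 a gV) lb.
  have hc := potential_walk ph (admissible_step n_gt1 m gV) lc.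
  apply: be_trans (bequiv_catl [:: m] hc) _.
  apply: be_trans (be_sym (bequiv_catl [:: a] hb)).
  have -> : walk (step V m) c = walk (step V a) b by rewrite -[LHS]/(walk V (m :: c)) -wbc.
  rewrite !catA; apply: bequiv_catr; exact: be_sym.
exists h' => V a gV lV lVa; have [ra|nra] := boolP (reducing V a); first exact: down.
have [u [pi rV]] := admissible_rep gV.
have := down _ (inv_move a) (admissible_step n_gt1 a gV) lVa.
rewrite /reducing step_inv // (weight_step n_gt1 rV nra) => /(_ isT) h1.
apply: be_sym; apply: be_trans (bequiv_catl [:: a] h1) _.
exact: (bequiv_catr (h' V) (be_free a)).
Qed.

Lemma below_exists V b : exists N, forall M, N <= M -> below M V b.
Proof.
elim: b V => [|a b IH] V /=; first by exists (weight V).+1 => M ->.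
have [N hN] := IH (step V a); exists (maxn (weight V).+1 N) => M.
by rewrite geq_max => /andP[-> /hN ->].
Qed.

Lemma walk_inj_bequiv V b c : admissible V -> walk V b = walk V c -> bequiv b c.
Proof.
move=> gV e; have [N hN] := below_exists V b; have [M hM] := below_exists V c.
have [h ph] := potential_exists (maxn N M).
have hb := potential_walk ph gV (hN _ (leq_maxl _ _)).
have hc := potential_walk ph gV (hM _ (leq_maxr _ _)).
rewrite -e in hc; have := be_trans (be_sym hb) hc.
move: (h _) => d bcd; apply: be_trans (_ : bequiv ((b ++ d) ++ winv d) _).
  by rewrite -catA -{1}[b]cats0; apply/bequiv_catl/be_sym/bequiv_winvr.
apply: be_trans (bequiv_catr _ bcd) _.
by rewrite -catA -{2}[c]cats0; apply/bequiv_catl/bequiv_winvr.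
Qed.

Lemma walk_cat V b c : walk V (b ++ c) = walk (walk V b) c.
Proof. exact: foldl_cat. Qed.

Lemma walk_winv V b : walk (walk V b) (winv b) = V.
Proof.
elim: b V => //= a b IH V; rewrite winv_cons -cats1 walk_cat IH /=.
exact: step_inv.
Qed.

Lemma admissible_walk_std V : admissible V -> exists b, walk V b = std_tuple n.
Proof.
have [N] := ubnP (weight V); elim: N V => // N IH V lN gV.
case: (single_absorber n_gt1 gV) => [->|[m /andP[rm _]]]; first by exists [::].
have [|b hb] := IH (step V m) _ (admissible_step n_gt1 m gV); last by exists (m :: b).
exact: leq_trans rm _.
Qed.

End Confluence.

(** * The representation *)

Section Artin.
Variable n : nat.
Implicit Types (i j k : 'I_n) (V f : 'I_n -> fgroup n) (b : bword n) (w : word n).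
Local Open Scope group_scope.

Definition ext V w : fgroup n := \prod_(a <- w) sgn a.2 (V a.1).

Lemma ext_cat V w w' : ext V (w ++ w') = ext V w * ext V w'.
Proof. exact: big_cat. Qed.

Lemma ext_seq1 V i e : ext V [:: (i, e)] = sgn e (V i).
Proof. exact: big_seq1. Qed.

Lemma ext_winv V w : ext V (winv w) = (ext V w)^-1.
Proof.
elim: w => [|a w IH]; first by rewrite /ext big_nil invg1.
rewrite winv_cons -cats1 ext_cat IH -(cat1s a) ext_cat invMg; congr (_ * _).
by case: a => i e; rewrite !ext_seq1 sgnK.
Qed.

Lemma ext_subst V (g : 'I_n -> word n) w : ext V (subst g w) = ext (fun k => ext V (g k)) w.
Proof.
elim: w => [|[i e] w IH]; first by rewrite /ext !big_nil.
rewrite -[(i, e) :: w]cat1s [RHS]ext_cat ext_seq1 -IH /subst /= ext_cat.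
by case: e; rewrite ?ext_winv.
Qed.

Lemma ext_std w : ext (std_tuple n) w = cls w.
Proof.
elim: w => [|[i e] w IH]; first by rewrite /ext big_nil.
by rewrite -(cat1s (i, e)) ext_cat IH cls_cat ext_seq1 ffunE sgn_x.
Qed.

Lemma cls_subst (g : 'I_n -> word n) w : cls (subst g w) = ext (fun k => cls (g k)) w.
Proof.
rewrite -ext_std ext_subst; apply: eq_bigr => a _.
by rewrite ext_std.
Qed.

Lemma ext_rho_gen (V : ftuple n) a k : 1 < n -> ext V (rho_gen a k) = step V a k.
Proof.
move=> n_gt1; case: a => i e; have := ordS_neq n_gt1 i => Si.
rewrite /rho_gen /step ffunE /absorber /absorbed; case: e => /=.
  rewrite /rho_sigma_inv; case: (eqVneq k i) => [->|ki].
    by rewrite eq_sym (negbTE Si) ext_seq1.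
  case: (eqVneq k (ordS i)) => [_|_]; last exact: ext_seq1.
  by rewrite /ext !big_cons big_nil /= mulg1 invgK mulgA.
rewrite /rho_sigma; case: (eqVneq k i) => [_|_].
  by rewrite /ext !big_cons big_nil /= mulg1 mulgA.
by case: (eqVneq k (ordS i)) => [_|_]; exact: ext_seq1.
Qed.

Lemma walk_rho (V : ftuple n) b k : 1 < n -> walk V b k = ext V (rho b k).
Proof.
move=> n_gt1; elim: b V k => [|a b IH] V k /=; first by rewrite /gen ext_seq1.
rewrite IH ext_subst; apply: eq_bigr => c _.
by rewrite ext_rho_gen.
Qed.

Lemma walk_std_rho b k : 1 < n -> walk (std_tuple n) b k = cls (rho b k).
Proof. by move=> n_gt1; rewrite walk_rho // ext_std. Qed.

Lemma cls_subst_prod_gens (g : 'I_n -> word n) :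
  cls (subst g (prod_gens n)) = prodV [ffun k => cls (g k)].
Proof.
rewrite cls_subst /ext /prod_gens big_map; apply: eq_bigr => k _.
by rewrite ffunE.
Qed.

End Artin.

Theorem theorem5p3 (n : nat) (hn : 2 <= n) :
  (* (i) injectivity of rho_Aff *)
  (forall b1 b2 : bword n,
      (forall k, feq (rho b1 k) (rho b2 k)) -> bequiv b1 b2) /\
  (* (ii) characterisation of the image *)
  (forall f : 'I_n -> word n, is_aut f ->
     ((exists b : bword n, forall k, feq (rho b k) (f k)) <->
      ((exists (w : 'I_n -> word n) (pi : {perm 'I_n}),
          forall k, feq (f k) (w k ++ gen (pi k) ++ winv (w k))) /\
       (exists w : word n, alg_len w = 0%R /\
          feq (subst f (prod_gens n)) (w ++ prod_gens n ++ winv w))))).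
Proof.
have clsE w v : cls (w ++ v ++ winv w) = (cls w * cls v * (cls w)^-1)%g.
  by rewrite !cls_cat cls_winv mulgA.
split=> [b1 b2 h|f _].
  apply: (walk_inj_bequiv hn (admissible_std n)); apply/ffunP => k.
  by rewrite !walk_std_rho //; apply/feqE.
split=> [[b hb]|[[w [pi hw]] [v [v0 hv]]]].
  have eV k : walk (std_tuple n) b k = cls (f k) by rewrite walk_std_rho //; apply/feqE.
  have [[u [pi [ipi _ _ eu]]] [v v0 ev]] := admissible_walk hn b (admissible_std n).
  split; first exists u, (perm ipi); first move=> k.
    by apply/feqE; rewrite -eV eu permE clsE.
  exists (val v); split=> //; apply/feqE; rewrite cls_subst_prod_gens clsE clsK -ev.
  by congr prodV; apply/ffunP => k; rewrite ffunE eV.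
pose V : ftuple n := [ffun k => cls (f k)].
have gV : admissible V.
  split.
    have [|u ru] := @rep_exists n V (fun k => cls (w k)) pi (@perm_inj _ pi); last by exists u, pi.
    by move=> k; rewrite ffunE -clsE; apply/feqE.
  exists (cls v); first by rewrite ell_cls.
  by rewrite -cls_subst_prod_gens -clsE; apply/feqE.
have [b hb] := admissible_walk_std hn gV.
exists (winv b) => k; apply/feqE; rewrite -walk_std_rho // -hb walk_winv //.
by rewrite ffunE.
Qed.
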